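(* Let $K,N,M\in\mathbb N$, let $(\mu^{(k)},\nu^{(k)})\in\Delta_N\times\Delta_M$, $k\in\{1,\dots,K\}$, be $K$ distinct pairs of marginals and let $\alpha^{(1)},\dots,\alpha^{(K)}\in\mathbb R$ be the observed total costs. For each choice of extreme points $u^{(k)}\in\operatorname{EP}(\mu^{(k)},\nu^{(k)})$, $k\in\{1,\dots,K\}$, consider the following system in the unknown $c\in\mathbb R^{N\times M}$: $$\langle c,v^{(k)}\rangle\ge\alpha^{(k)}\ \text{ for all } v^{(k)}\in\operatorname{EP}(\mu^{(k)},\nu^{(k)})\setminus\{u^{(k)}\},\qquad \langle c,u^{(k)}\rangle=\alpha^{(k)},\qquad k\in\{1,\dots,K\}.\tag{$*$}$$ (a) Suppose that at least one consistent cost matrix exists. Then the cost matrix is identifiable in $\mathbb R^{N\times M}$ from the marginals and total costs if and only if, for all possible choices of $u^{(k)}\in\operatorname{EP}(\mu^{(k)},\nu^{(k)})$, $k\in\{1,\dots,K\}$, the system $( * )$ is either inconsistent (has no solution) or has a unique solution, and this solution does not depend on the choice of $(u^{(k)})_{k}$. (b) (Without assuming in advance that a consistent cost matrix exists.) If $( * )$ has a solution for some choice of $(u^{(k)})_k$, then a consistent cost matrix exists.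
   Context: $\Delta_N=\{x\in\mathbb R^N: x_i\ge 0,\ \sum_i x_i=1\}$. For $\mu\in\Delta_N$, $\nu\in\Delta_M$, $\Pi(\mu,\nu)$ is the set of $N\times M$ matrices with nonnegative entries, row sums $\mu$ and column sums $\nu$ (transport plans); $\operatorname{EP}(\mu,\nu)$ is the finite set of extreme points of the polytope $\Pi(\mu,\nu)$. For a cost matrix $c\in\mathbb R^{N\times M}$, the total cost is $\mathcal T_c(\mu,\nu)=\min_{\pi\in\Pi(\mu,\nu)}\langle c,\pi\rangle$, where $\langle\cdot,\cdot\rangle$ is the Frobenius inner product. Here the observed information consists of the pairs of marginals and the total costs. A cost matrix $c\in\mathbb R^{N\times M}$ is called consistent if $\mathcal T_c(\mu^{(k)},\nu^{(k)})=\alpha^{(k)}$ for all $k\in\{1,\dots,K\}$. When discussing identifiability it is always assumed that at least one consistent cost matrix exists (the underlying cost matrix); the cost matrix is identifiable in $\mathbb R^{N\times M}$ if there is exactly one consistent cost matrix. *)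

(* Defs.v *)
From HB Require Import structures.
From mathcomp Require Import all_boot all_order all_algebra.
From mathcomp Require Import all_classical all_reals all_analysis.

Set Implicit Arguments.
Unset Strict Implicit.
Unset Printing Implicit Defensive.

Import Order.TTheory GRing.Theory Num.Theory.
Import numFieldNormedType.Exports.

Local Open Scope classical_set_scope.
Local Open Scope ring_scope.

Definition simplex (R : realType) (n : nat) : set 'rV[R]_n :=
  [set x | (forall i, 0 <= x 0 i) /\ \sum_i x 0 i = 1].

Definition transport_plans (R : realType) (N M : nat)
    (mu : 'rV[R]_N) (nu : 'rV[R]_M) : set 'M[R]_(N, M) :=
  [set p | [/\ forall i j, 0 <= p i j,
               forall i, \sum_j p i j = mu 0 i &
               forall j, \sum_i p i j = nu 0 j]].

Definition extreme_points (R : realType) (E : lmodType R) (A : set E) : set E :=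
  [set x | A x /\ forall y z (t : R), A y -> A z -> 0 < t < 1 ->
     x = t *: y + (1 - t) *: z -> y = x /\ z = x].

Definition EP (R : realType) (N M : nat) (mu : 'rV[R]_N) (nu : 'rV[R]_M) :
    set 'M[R]_(N, M) :=
  extreme_points (transport_plans mu nu).

Definition frob (R : realType) (N M : nat) (c p : 'M[R]_(N, M)) : R :=
  \sum_i \sum_j c i j * p i j.

(* For marginals in the simplices this infimum is a minimum: see
   [total_cost_min] below. *)
Definition total_cost (R : realType) (N M : nat) (c : 'M[R]_(N, M))
    (mu : 'rV[R]_N) (nu : 'rV[R]_M) : R :=
  inf [set frob c p | p in transport_plans mu nu].

Definition consistent (R : realType) (K N M : nat)
    (mu : 'I_K -> 'rV[R]_N) (nu : 'I_K -> 'rV[R]_M) (alpha : 'I_K -> R)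
    (c : 'M[R]_(N, M)) : Prop :=
  forall k, total_cost c (mu k) (nu k) = alpha k.

Definition identifiable (R : realType) (K N M : nat)
    (mu : 'I_K -> 'rV[R]_N) (nu : 'I_K -> 'rV[R]_M) (alpha : 'I_K -> R) : Prop :=
  exists! c : 'M[R]_(N, M), consistent mu nu alpha c.

Definition EP_choice (R : realType) (K N M : nat)
    (mu : 'I_K -> 'rV[R]_N) (nu : 'I_K -> 'rV[R]_M)
    (u : 'I_K -> 'M[R]_(N, M)) : Prop :=
  forall k, EP (mu k) (nu k) (u k).

Definition solves_system (R : realType) (K N M : nat)
    (mu : 'I_K -> 'rV[R]_N) (nu : 'I_K -> 'rV[R]_M) (alpha : 'I_K -> R)
    (u : 'I_K -> 'M[R]_(N, M)) (c : 'M[R]_(N, M)) : Prop :=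
  forall k,
    (forall v, (EP (mu k) (nu k) `\ u k) v -> alpha k <= frob c v) /\
    frob c (u k) = alpha k.

Lemma transport_plans_neq0 (R : realType) (N M : nat)
    (mu : 'rV[R]_N) (nu : 'rV[R]_M) :
  simplex mu -> simplex nu -> transport_plans mu nu !=set0.
Proof.
move=> [mu0 mu1] [nu0 nu1]; exists (\matrix_(i, j) (mu 0 i * nu 0 j)).
split=> [i j|i|j].
- by rewrite mxE mulr_ge0.
- by under eq_bigr do rewrite mxE; rewrite -mulr_sumr nu1 mulr1.
- by under eq_bigr do rewrite mxE; rewrite -mulr_suml mu1 mul1r.
Qed.

Lemma continuous_vec_coord (R : realType) (N M : nat) (i : 'I_N) (j : 'I_M) :
  continuous (fun v : 'rV[R]_(N * M) => (vec_mx v : 'M[R]_(N, M)) i j).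
Proof.
have -> : (fun v : 'rV[R]_(N * M) => (vec_mx v : 'M[R]_(N, M)) i j) =
          (fun v => v 0 (mxvec_index i j)) by apply/funext => v; rewrite mxE.
exact: coord_continuous.
Qed.

Lemma compact_transport_plans (R : realType) (N M : nat)
    (mu : 'rV[R]_N) (nu : 'rV[R]_M) : simplex mu ->
  compact [set v : 'rV[R]_(N * M) | transport_plans mu nu (vec_mx v)].
Proof.
move=> [mu0 mu1]; set S := mkset _.
have -> : S =
    (\bigcap_i \bigcap_j [set v : 'rV[R]_(N * M) |
        [set x | 0 <= x] ((vec_mx v : 'M[R]_(N, M)) i j)]) `&`
    ((\bigcap_i [set v : 'rV[R]_(N * M) |
        [set x | x = mu 0 i] (\sum_j (vec_mx v : 'M[R]_(N, M)) i j)]) `&`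
     (\bigcap_j [set v : 'rV[R]_(N * M) |
        [set x | x = nu 0 j] (\sum_i (vec_mx v : 'M[R]_(N, M)) i j)])).
  apply/seteqP; split=> v /=.
    move=> [h1 h2 h3]; split; [|split].
    + by move=> i _ j _; exact: h1.
    + by move=> i _; exact: h2.
    + by move=> j _; exact: h3.
  by move=> [h1 [h2 h3]]; split=> [i j|i|j];
    [exact: (h1 i I j I)|exact: (h2 i I)|exact: (h3 j I)].
set C := (X in compact X).
have CS v : C v -> transport_plans mu nu (vec_mx v).
  by move=> [h1 [h2 h3]]; split=> [i j|i|j];
    [exact: (h1 i I j I)|exact: (h2 i I)|exact: (h3 j I)].
have cadd : forall n (F : 'I_n -> 'rV[R]_(N * M) -> R),
    (forall i, continuous (F i)) -> continuous (fun v => \sum_i F i v).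
  by move=> n F cF; apply: (continuous_big (op := +%R)) => //;
    exact: add_continuous.
apply: (@subclosed_compact _ _
    [set v : 'rV[R]_(N * M) | forall k, `[0, 1]%classic (v 0 k)]).
- apply: closedI; [|apply: closedI].
  + apply: closed_bigI => i _; apply: closed_bigI => j _.
    have /continuous_closedP/(_ _ (@closed_ge R 0)) := @continuous_vec_coord R N M i j.
    by [].
  + apply: closed_bigI => i _.
    have /cadd/continuous_closedP/(_ _ (@closed_eq R (mu 0 i))) := @continuous_vec_coord R N M i.
    by [].
  + apply: closed_bigI => j _.
    have /cadd/continuous_closedP/(_ _ (@closed_eq R (nu 0 j))) :=
      fun i => @continuous_vec_coord R N M i j.
    by [].
- apply: (@rV_compact R _ (fun=> `[0, 1]%classic)) => k.
  exact: segment_compact.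
- move=> v /CS [h0 h1 _] k; case/mxvec_indexP: k => i j.
  have := h0 i j; have := h1 i; rewrite (bigD1 j) //= => hi hij.
  have hm : mu 0 i <= 1 by rewrite -mu1 (bigD1 i) //= lerDl sumr_ge0.
  rewrite mxE in hij; rewrite /= in_itv /= hij /=.
  apply: le_trans hm; rewrite -hi mxE lerDl sumr_ge0 // => l _; exact: h0.
Qed.

Lemma total_cost_min (R : realType) (N M : nat) (c : 'M[R]_(N, M))
    (mu : 'rV[R]_N) (nu : 'rV[R]_M) : simplex mu -> simplex nu ->
  (exists2 p, transport_plans mu nu p & total_cost c mu nu = frob c p) /\
  (forall p, transport_plans mu nu p -> total_cost c mu nu <= frob c p).
Proof.
move=> smu snu; have [q qP] := transport_plans_neq0 smu snu.
have [|||v] := @EVT_min_rV R (N * M) (fun v => frob c (vec_mx v))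
  [set v | transport_plans mu nu (vec_mx v)].
- by exists (mxvec q); rewrite /= mxvecK.
- exact: compact_transport_plans.
- apply: continuous_subspaceT; rewrite /frob.
  apply: (continuous_big (op := +%R)) => [|i _]; first exact: add_continuous.
  apply: (continuous_big (op := +%R)) => [|j _ v]; first exact: add_continuous.
  by apply: continuousM; [exact: cst_continuous | exact: continuous_vec_coord].
rewrite inE /= => vP vmin.
set A := [set frob c p | p in transport_plans mu nu].
have lbv : lbound A (frob c (vec_mx v)).
  move=> _ [p pP <-]; have := vmin (mxvec p).
  by rewrite inE /= mxvecK => /(_ pP).
have infA : total_cost c mu nu = frob c (vec_mx v).
  apply/eqP; rewrite eq_le; apply/andP; split.
    by apply: (ge_inf (ex_intro _ _ lbv)); exists (vec_mx v).
  by apply: lb_le_inf => //; exists (frob c q), q.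
split; first by exists (vec_mx v).
by move=> p pP; rewrite infA; apply: lbv; exists p.
Qed.

(* Main.v *)
Require Import Defs.
From mathcomp Require Import all_boot all_order all_algebra.
From mathcomp Require Import all_classical all_reals all_analysis.
From mathcomp Require Import ring lra.

(** Everything reduces to one fact of linear programming: over a transport
    polytope every linear cost attains its minimum at an extreme point
    ([total_cost_attained_at_EP]).  Granting it, a cost matrix is consistent
    exactly when it solves the system for some choice of extreme points
    ([consistentP]): for the choice take optimal extreme points; conversely, the
    inequalities bound the cost below at all extreme points, in particular at
    an optimal one, while the equality shows that the bound is reached.  Hence
    the set of consistent matrices is the union, over all choices, of the
    solution sets of the systems.  A nonempty union is a singleton if and only
    if any two solutions, of possibly different systems, coincide; and the
    union is nonempty as soon as one of the systems has a solution.

    For the optimal extreme point, compactness of the polytope provides an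
    optimal plan, and it remains to make its support small.  If an optimal plan
    [x] is not extreme, it is a proper convex combination of plans, which are
    again optimal and, entries being nonnegative, supported in the support of
    [x]; one of them, [y], differs from [x].  Moving from [x] away from [y]
    along the line through both preserves marginals and cost, and the move can
    be continued until some positive entry of [x] first vanishes
    ([support_reduction]).  The result is an optimal plan of strictly smaller
    support, so that this process stops, at an extreme point. *)

Set Implicit Arguments.
Unset Strict Implicit.
Unset Printing Implicit Defensive.

Import Order.TTheory GRing.Theory Num.Theory.
Local Open Scope classical_set_scope.
Local Open Scope ring_scope.

(** * Optimal extreme points of the transport polytope *)

Definition supp (R : realType) (N M : nat) (x : 'M[R]_(N, M)) :
    {set 'I_N * 'I_M} :=
  [set ij | x ij.1 ij.2 != 0]%SET.

Lemma frob_comb (R : realType) (N M : nat) (c x y : 'M[R]_(N, M)) (a b : R) :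
  frob c (a *: x + b *: y) = a * frob c x + b * frob c y.
Proof.
rewrite /frob !mulr_sumr -big_split; apply: eq_bigr => i _ /=.
rewrite !mulr_sumr -big_split; apply: eq_bigr => j _ /=.
by rewrite !mxE; ring.
Qed.

(** Domination of one plan by another forces equality, because the differences
    in each row are nonnegative and sum to zero. *)
Lemma transport_plans_le_eq (R : realType) (N M : nat) (mu : 'rV[R]_N)
    (nu : 'rV[R]_M) (x y : 'M[R]_(N, M)) :
  transport_plans mu nu x -> transport_plans mu nu y ->
  (forall i j, y i j <= x i j) -> y = x.
Proof.
move=> [_ rx _] [_ ry _] le_yx; apply/matrixP => i j; apply/eqP.
have /eqP : \sum_l (x i l - y i l) = 0 by rewrite sumrB rx ry subrr.
rewrite psumr_eq0 => [/allP/(_ j (mem_index_enum _))|l _]; last first.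
  by rewrite subr_ge0.
by rewrite /= subr_eq0 eq_sym.
Qed.

(** The largest ratio [y i j / x i j] over the support of [x] decides how far
    one can move from [x] away from [y] inside the polytope: the entry that
    attains it is the first to vanish. *)
Lemma support_reduction (R : realType) (N M : nat) (mu : 'rV[R]_N)
    (nu : 'rV[R]_M) (x y : 'M[R]_(N, M)) :
  transport_plans mu nu x -> transport_plans mu nu y ->
  (supp y \subset supp x)%SET -> y <> x ->
  exists s : R,
    let w := (1 + s) *: x + (- s) *: y in
    transport_plans mu nu w /\ (supp w \proper supp x)%SET.
Proof.
move=> Px Py /fintype.subsetP sub_yx neq_yx.
have [x0 rx cx] := Px; have [y0 ry cy] := Py.
have [[i0 j0] lt_xy] : exists ij : 'I_N * 'I_M, x ij.1 ij.2 < y ij.1 ij.2.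
  apply: contra_notP neq_yx => nlt; apply: (transport_plans_le_eq Px Py) => i j.
  by rewrite leNgt; apply/negP => lt_xy; apply: nlt; exists (i, j).
have pos ij : ij \in supp x -> 0 < x ij.1 ij.2.
  by rewrite inE lt_def x0 andbT.
have s0 : (i0, j0) \in supp x.
  by apply: sub_yx; rewrite inE gt_eqF // (le_lt_trans _ lt_xy).
case: (Order.TotalTheory.arg_maxP
  (fun ij : 'I_N * 'I_M => y ij.1 ij.2 / x ij.1 ij.2) s0) => m sm maxm.
set r := y m.1 m.2 / x m.1 m.2 in maxm.
have r1 : 1 < r.
  by apply: lt_le_trans (maxm _ s0); rewrite ltr_pdivlMr ?mul1r ?pos.
have r1_gt0 : 0 < r - 1 by rewrite subr_gt0.
have r1_neq0 : r - 1 != 0 by rewrite gt_eqF.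
have zero_out ij : ij \notin supp x -> x ij.1 ij.2 = 0 /\ y ij.1 ij.2 = 0.
  move=> nx; split; first by move: nx; rewrite inE negbK => /eqP.
  by have := contra (sub_yx ij) nx; rewrite inE negbK => /eqP.
have le_yrx i j : y i j <= r * x i j.
  have [sij|/zero_out[/= -> ->]] := boolP ((i, j) \in supp x); last first.
    by rewrite mulr0.
  by have := maxm _ sij; rewrite /= ler_pdivrMr ?(pos _ sij).
(* With this step size the new plan is (r x - y) / (r - 1). *)
pose s := (r - 1)^-1; exists s; cbv zeta.
have wE i j : ((1 + s) *: x + (- s) *: y) i j = s * (r * x i j - y i j).
  by rewrite !mxE /s; field.
split.
  split=> [i j|i|j].
  - by rewrite wE mulr_ge0 ?subr_ge0 // invr_ge0 ltW.
  - under eq_bigr do rewrite !mxE.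
    by rewrite big_split -!mulr_sumr rx ry /=; ring.
  - under eq_bigr do rewrite !mxE.
    by rewrite big_split -!mulr_sumr cx cy /=; ring.
apply/fintype.properP; split.
  apply/fintype.subsetP => ij; apply: contraLR => /zero_out[xij yij].
  by rewrite inE wE xij yij mulr0 subr0 mulr0 eqxx.
exists m => //; rewrite inE wE negbK /r divfK ?subrr ?mulr0 //.
by rewrite gt_eqF ?pos.
Qed.

(** The optimal plans form a face: both ends of a convex combination that is
    optimal are optimal, and their supports cannot exceed that of the
    combination, as nonnegative entries do not cancel.  Stated for one end, the
    other one following by exchanging [t] and [1 - t]. *)
Lemma optimal_face (R : realType) (N M : nat) (mu : 'rV[R]_N)
    (nu : 'rV[R]_M) (c y z : 'M[R]_(N, M)) (t : R) :
  let x := t *: y + (1 - t) *: z in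
  transport_plans mu nu y -> transport_plans mu nu z -> 0 < t < 1 ->
  (forall p, transport_plans mu nu p -> frob c x <= frob c p) ->
  frob c y = frob c x /\ (supp y \subset supp x)%SET.
Proof.
move=> x Py Pz /andP[t0 t1] minx; split.
  have := minx _ Py; have := minx _ Pz; rewrite /x frob_comb.
  move: (frob c y) (frob c z) => a b hb ha.
  have le_ab : a <= b by rewrite -(ler_pM2l t0); lra.
  have le_ba : b <= a by rewrite -subr_ge0 -(pmulr_rge0 _ (_ : 0 < 1 - t)); lra.
  have -> : b = a by apply/eqP; rewrite eq_le le_ab le_ba.
  by ring.
have [y0 _ _] := Py; have [z0 _ _] := Pz.
apply/fintype.subsetP => ij; rewrite !inE => yij.
rewrite !mxE gt_eqF // ltr_pwDl ?mulr_ge0 ?subr_ge0 ?(ltW t1) //.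
by rewrite mulr_gt0 // lt_def yij y0.
Qed.

(** Induction on the size of the support: a plan that is not extreme is traded
    for one of the same cost and smaller support. *)
Lemma optimal_EP (R : realType) (N M : nat) (mu : 'rV[R]_N)
    (nu : 'rV[R]_M) (c x : 'M[R]_(N, M)) :
  transport_plans mu nu x ->
  (forall p, transport_plans mu nu p -> frob c x <= frob c p) ->
  exists2 u, EP mu nu u & frob c u = frob c x.
Proof.
have [n] := ubnP #|supp x|; elim: n x => // n IHn x le_xn Px minx.
have [[y [Py cy sub_yx neq_yx]]|no_y] := pselect (exists y,
    [/\ transport_plans mu nu y, frob c y = frob c x,
        (supp y \subset supp x)%SET & y <> x]).
  have [s [Pw prop_wx]] := support_reduction Px Py sub_yx neq_yx.
  have cw : frob c ((1 + s) *: x + (- s) *: y) = frob c x.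
    by rewrite frob_comb cy; ring.
  rewrite -cw; apply: IHn => //; last by rewrite cw.
  exact: leq_trans (proper_card prop_wx) le_xn.
exists x => //; split=> // y z t Py Pz t01 xE.
have eq_x p : transport_plans mu nu p ->
    frob c p = frob c x /\ (supp p \subset supp x)%SET -> p = x.
  by move=> Pp [cp sp]; apply: contra_notP no_y => neq; exists p.
split; apply: eq_x => //.
  by rewrite xE; apply: optimal_face Py Pz t01 _; rewrite -xE.
have xE' : x = (1 - t) *: z + (1 - (1 - t)) *: y.
  by rewrite subKr addrC.
rewrite xE'; apply: optimal_face Pz Py _ _; last by rewrite -xE'.
by move: t01 => /andP[? ?]; apply/andP; split; lra.
Qed.

Lemma total_cost_attained_at_EP (R : realType) (N M : nat) (c : 'M[R]_(N, M))
    (mu : 'rV[R]_N) (nu : 'rV[R]_M) : simplex mu -> simplex nu ->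
  exists2 u, EP mu nu u & frob c u = total_cost c mu nu.
Proof.
move=> smu snu; have [[x Px cx] minx] := total_cost_min c smu snu.
by rewrite cx in minx *; exact: optimal_EP.
Qed.

(** * Consistent cost matrices as solutions of the systems *)

Lemma consistentP (R : realType) (K N M : nat)
    (mu : 'I_K -> 'rV[R]_N) (nu : 'I_K -> 'rV[R]_M) (alpha : 'I_K -> R)
    (c : 'M[R]_(N, M)) :
  (forall k, simplex (mu k)) -> (forall k, simplex (nu k)) ->
  consistent mu nu alpha c <->
  exists2 u, EP_choice mu nu u & solves_system mu nu alpha u c.
Proof.
move=> smu snu; split=> [cons|[u EPu sol] k].
  have /choice[u uP] k : exists u, EP (mu k) (nu k) u /\ frob c u = alpha k.
    have [u EPu cu] := total_cost_attained_at_EP c (smu k) (snu k).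
    by exists u; rewrite cu cons.
  exists u => k; first by have [] := uP k.
  split; last by have [] := uP k.
  move=> v [[Pv _] _]; rewrite -cons.
  by have [_] := total_cost_min c (smu k) (snu k); apply.
have [ge_alpha cu] := sol k.
have [w EPw cw] := total_cost_attained_at_EP c (smu k) (snu k).
apply/eqP; rewrite eq_le; apply/andP; split.
  rewrite -cu; have [_] := total_cost_min c (smu k) (snu k); apply.
  by have [] := EPu k.
rewrite -cw; have [->|neq_wu] := pselect (w = u k); first by rewrite cu.
exact: ge_alpha.
Qed.

Theorem theorem2p6 (R : realType) (K N M : nat)
    (mu : 'I_K -> 'rV[R]_N) (nu : 'I_K -> 'rV[R]_M) (alpha : 'I_K -> R)
    (mu_simplex : forall k, simplex (mu k))
    (nu_simplex : forall k, simplex (nu k))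
    (distinct : injective (fun k => (mu k, nu k))) :
  ((exists c : 'M[R]_(N, M), consistent mu nu alpha c) ->
    (identifiable mu nu alpha <->
      (forall u : 'I_K -> 'M[R]_(N, M), EP_choice mu nu u ->
         (~ exists c, solves_system mu nu alpha u c) \/
         (exists! c, solves_system mu nu alpha u c)) /\
      (forall (u u' : 'I_K -> 'M[R]_(N, M)) (c c' : 'M[R]_(N, M)),
         EP_choice mu nu u -> EP_choice mu nu u' ->
         solves_system mu nu alpha u c -> solves_system mu nu alpha u' c' ->
         c = c')))
  /\
  ((exists u : 'I_K -> 'M[R]_(N, M), EP_choice mu nu u /\ exists c, solves_system mu nu alpha u c) ->
    exists c : 'M[R]_(N, M), consistent mu nu alpha c).
Proof.
have consP c := consistentP alpha c mu_simplex nu_simplex.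
split=> [[c0 cons0]|[u [EPu [c sol]]]]; last first.
  by exists c; apply/consP; exists u.
split=> [[c1 [_ uniq_c1]]|[_ all_eq]].
  have all_c1 u c : EP_choice mu nu u -> solves_system mu nu alpha u c -> c1 = c.
    by move=> EPu sol; apply: uniq_c1; apply/consP; exists u.
  split=> [u EPu|u u' c c' EPu EPu' sol sol']; last first.
    by rewrite -(all_c1 _ _ EPu sol) (all_c1 _ _ EPu' sol').
  have [[c sol]|no_sol] := pselect (exists c, solves_system mu nu alpha u c).
    right; exists c; split=> // c' sol'.
    by rewrite -(all_c1 _ _ EPu sol) (all_c1 _ _ EPu sol').
  by left.
exists c0; split=> // c /consP[u EPu sol].
by have /consP[u0 EPu0 sol0] := cons0; exact: all_eq sol0 sol.
Qed.
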